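(* The problem $\mathsf{FP}(\Sigma^0_2)$ is not Weihrauch reducible to $\mathsf{ATR}_2$, i.e. $\mathsf{FP}(\Sigma^0_2)\not\leq_W \mathsf{ATR}_2$.
   Context: A (Weihrauch) problem is a partial function $\mathsf{P}$ from $\mathcal{P}(\omega)$ to $\mathcal{P}(\mathcal{P}(\omega))$ with nonempty domain; for $X\in\mathrm{dom}(\mathsf{P})$ (an input) the elements of $\mathsf{P}(X)$ are its outputs. Numbers, functions, finite tuples and infinite sequences of sets, and subsets of $\omega^n$ are identified with subsets of $\omega$ via canonical computable bijections. $\mathsf{P}\leq_W\mathsf{Q}$ means there are computable functionals $\Phi,\Psi$ such that for all $X\in\mathrm{dom}(\mathsf{P})$, $\Phi(X)$ is defined and in $\mathrm{dom}(\mathsf{Q})$, and for all $Y\in\mathsf{Q}(\Phi(X))$, $\Psi(X,Y)$ is defined and in $\mathsf{P}(X)$. $X$-positive formula: a formula $\varphi(n,X,Y)$ of second-order arithmetic in negation normal form with no subformula of the form $t\notin X$. $\mathsf{FP}(\Sigma^0_2)$: an input is a set $A\subseteq\omega$ together with a G\''odel number of an $X$-positive $\Sigma^0_2$ formula $\varphi(n,X,Y)$; an output is a fixed point of the operator $X\mapsto\{n:\varphi(n,X,A)\}$ on $\mathcal{P}(\omega)$. For a linear order $L\subseteq\omega^2$ with field $|L|$ and a set $A$, a jump hierarchy of $(L,A)$ is a sequence $X=\langle X_i\rangle_{i\in|L|}$ such that for each $i\in|L|$, $X_i=A$ if $i=\min_L$ and $X_i=(X_{<_L i})'$ otherwise,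 where $X_{<_L i}=\langle X_j\rangle_{j<_L i}$ and $'$ is the Turing jump. $\mathsf{ATR}_2$: an input is a linear order $L$ and a set $A$; an output is a jump hierarchy of $(L,A)$ or an infinite descending sequence of $L$. *)

(* Defs.v *)
From mathcomp Require Import all_boot boolp classical_sets.
From Stdlib Require Cantor.

Set Implicit Arguments.
Unset Strict Implicit.
Unset Printing Implicit Defensive.

Local Open Scope classical_set_scope.

Definition npair (i j : nat) : nat := Cantor.to_nat (i, j).
Definition fstn (n : nat) : nat := (Cantor.of_nat n).1.
Definition sndn (n : nat) : nat := (Cantor.of_nat n).2.

Lemma npair_inj i j i' j' : npair i j = npair i' j' -> i = i' /\ j = j'.
Proof. by move=> /Cantor.to_nat_inj[-> ->]. Qed.

(* A set [X] codes the sequence whose [i]-th entry is [column X i]; a finite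
   tuple of sets (here only a pair) is coded by [join]. *)
Definition column (X : set nat) (i : nat) : set nat := [set n | X (npair i n)].
Definition join (A B : set nat) : set nat :=
  [set n | if odd n then B n./2 else A n./2].

Definition graph (f : nat -> nat) : set nat :=
  [set m | exists n, m = npair n (f n)].

(* Partial recursive functions of one argument, multiple arguments being
   passed through [npair]. *)
Inductive code : Type :=
  | CZero | CSucc | CFst | CSnd
  | COracle
  | CPair of code & code
  | CComp of code & code
  | CRec of code & code
  | CMu of code.

(* [eval O c x y]: the program [c] with oracle [O] halts on [x] with output
   [y].  [CRec c d] is primitive recursion, on inputs <a,n>:
     h(a,0) = c(a),  h(a,n+1) = d(a,n,h(a,n));
   [CMu c] maps [a] to the least [m] with c(a,m) = 0, provided c(a,k) is
   defined for all k < m. *)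
Fixpoint eval (O : set nat) (c : code) (x y : nat) : Prop :=
  match c with
  | CZero => y = 0
  | CSucc => y = x.+1
  | CFst => y = fstn x
  | CSnd => y = sndn x
  | COracle => (O x /\ y = 1) \/ (~ O x /\ y = 0)
  | CPair c d => exists u v, [/\ eval O c x u, eval O d x v & y = npair u v]
  | CComp c d => exists2 z, eval O d x z & eval O c z y
  | CRec c d =>
      (fix rec (n r : nat) : Prop :=
         match n with
         | 0 => eval O c (fstn x) r
         | n'.+1 =>
             exists2 s, rec n' s & eval O d (npair (fstn x) (npair n' s)) r
         end) (sndn x) y
  | CMu c =>
      eval O c (npair x y) 0 /\
      forall k, k < y -> exists r, eval O c (npair x k) r.+1
  end.

Fixpoint code_num (c : code) : nat :=
  match c with
  | CZero => npair 0 0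
  | CSucc => npair 1 0
  | CFst => npair 2 0
  | CSnd => npair 3 0
  | COracle => npair 4 0
  | CPair c d => npair 5 (npair (code_num c) (code_num d))
  | CComp c d => npair 6 (npair (code_num c) (code_num d))
  | CRec c d => npair 7 (npair (code_num c) (code_num d))
  | CMu c => npair 8 (code_num c)
  end.

Lemma code_num_inj : injective code_num.
Proof.
elim=> [||||| c IHc d IHd | c IHc d IHd | c IHc d IHd | c IHc]
  [||||| c' d' | c' d' | c' d' | c'] /npair_inj[] // _.
- by case/npair_inj => /IHc -> /IHd ->.
- by case/npair_inj => /IHc -> /IHd ->.
- by case/npair_inj => /IHc -> /IHd ->.
- by move/IHc ->.
Qed.

(* The Turing jump; numbers that are not of the form [code_num c] are indices
   of the nowhere defined function. *)
Definition jump (X : set nat) : set nat :=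
  [set e | exists c, e = code_num c /\ exists y, eval X c e y].

(* The computable functional given by the program [c] is defined at [X] and
   takes the value [Z]. *)
Definition computes (c : code) (X Z : set nat) : Prop :=
  forall n, (Z n /\ eval X c n 1) \/ (~ Z n /\ eval X c n 0).

(* [outputs X] is meaningful only for [X] in [inputs]. *)
Record problem := Problem {
  inputs : set (set nat);
  outputs : set nat -> set (set nat);
  inputs_nonempty : inputs !=set0
}.

Definition weihrauch_le (P Q : problem) : Prop :=
  exists Phi Psi : code, forall X, inputs P X ->
    exists2 Z, computes Phi X Z &
      inputs Q Z /\
      forall Y, outputs Q Z Y ->
        exists2 W, computes Psi (join X Y) W & outputs P X W.

Notation "P <=W Q" := (weihrauch_le P Q) (at level 70, no associativity).

Inductive term : Type :=
  | TVar of nat | TZero | TOne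
  | TAdd of term & term
  | TMul of term & term.

(* Number variables and set variables are both named by natural numbers.
   [FExLt x t f] and [FAllLt x t f] are the bounded quantifiers. *)
Inductive formula : Type :=
  | FEq of term & term
  | FLt of term & term
  | FMem of term & nat
  | FNot of formula
  | FAnd of formula & formula
  | FOr of formula & formula
  | FImp of formula & formula
  | FExLt of nat & term & formula
  | FAllLt of nat & term & formula
  | FEx of nat & formula
  | FAll of nat & formula
  | FExSet of nat & formula
  | FAllSet of nat & formula.

Definition update (T : Type) (v : nat -> T) (x : nat) (a : T) : nat -> T :=
  fun y => if y == x then a else v y.

Fixpoint teval (v : nat -> nat) (t : term) : nat :=
  match t with
  | TVar x => v x
  | TZero => 0
  | TOne => 1
  | TAdd s t => teval v s + teval v t
  | TMul s t => teval v s * teval v t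
  end.

(* Truth in the standard model, the set quantifiers ranging over all subsets
   of the natural numbers. *)
Fixpoint sat (v : nat -> nat) (V : nat -> set nat) (f : formula) : Prop :=
  match f with
  | FEq s t => teval v s = teval v t
  | FLt s t => teval v s < teval v t
  | FMem t Z => V Z (teval v t)
  | FNot f => ~ sat v V f
  | FAnd f g => sat v V f /\ sat v V g
  | FOr f g => sat v V f \/ sat v V g
  | FImp f g => sat v V f -> sat v V g
  | FExLt x t f => exists2 a, a < teval v t & sat (update v x a) V f
  | FAllLt x t f => forall a, a < teval v t -> sat (update v x a) V f
  | FEx x f => exists a, sat (update v x a) V f
  | FAll x f => forall a, sat (update v x a) V f
  | FExSet Z f => exists S, sat v (update V Z S) f
  | FAllSet Z f => forall S, sat v (update V Z S) f
  end.

Fixpoint tvars (t : term) : seq nat :=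
  match t with
  | TVar x => [:: x]
  | TZero | TOne => [::]
  | TAdd s t | TMul s t => tvars s ++ tvars t
  end.

Fixpoint free_vars (f : formula) : seq nat :=
  match f with
  | FEq s t | FLt s t => tvars s ++ tvars t
  | FMem t _ => tvars t
  | FNot f | FExSet _ f | FAllSet _ f => free_vars f
  | FAnd f g | FOr f g | FImp f g => free_vars f ++ free_vars g
  | FExLt x t f | FAllLt x t f => tvars t ++ [seq y <- free_vars f | y != x]
  | FEx x f | FAll x f => [seq y <- free_vars f | y != x]
  end.

Fixpoint free_setvars (f : formula) : seq nat :=
  match f with
  | FEq _ _ | FLt _ _ => [::]
  | FMem _ Z => [:: Z]
  | FNot f | FExLt _ _ f | FAllLt _ _ f | FEx _ f | FAll _ f => free_setvars f
  | FAnd f g | FOr f g | FImp f g => free_setvars f ++ free_setvars g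
  | FExSet Z f | FAllSet Z f => [seq W <- free_setvars f | W != Z]
  end.

(* The formula has the form phi(n,X,Y): its only free variables are the
   number variable [var_n] and the set variables [var_X] and [var_Y]. *)
Definition var_n : nat := 0.
Definition var_X : nat := 0.
Definition var_Y : nat := 1.

Definition free_in_nXY (f : formula) : bool :=
  all (pred1 var_n) (free_vars f) && all (pred2 var_X var_Y) (free_setvars f).

Definition atomic (f : formula) : bool :=
  match f with FEq _ _ | FLt _ _ | FMem _ _ => true | _ => false end.

(* Negation normal form: no implication, negation on atomic formulas only. *)
Fixpoint nnf (f : formula) : bool :=
  match f with
  | FEq _ _ | FLt _ _ | FMem _ _ => true
  | FNot f => atomic f
  | FAnd f g | FOr f g => nnf f && nnf g
  | FImp _ _ => false
  | FExLt _ _ f | FAllLt _ _ f | FEx _ f | FAll _ f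
  | FExSet _ f | FAllSet _ f => nnf f
  end.

Fixpoint has_notin (Z : nat) (f : formula) : bool :=
  match f with
  | FEq _ _ | FLt _ _ | FMem _ _ => false
  | FNot (FMem _ W) => W == Z
  | FNot f => has_notin Z f
  | FAnd f g | FOr f g | FImp f g => has_notin Z f || has_notin Z g
  | FExLt _ _ f | FAllLt _ _ f | FEx _ f | FAll _ f
  | FExSet _ f | FAllSet _ f => has_notin Z f
  end.

Definition X_positive (f : formula) : bool :=
  [&& free_in_nXY f, nnf f & ~~ has_notin var_X f].

Fixpoint Sigma00 (f : formula) : bool :=
  match f with
  | FEq _ _ | FLt _ _ | FMem _ _ => true
  | FNot f => Sigma00 f
  | FAnd f g | FOr f g | FImp f g => Sigma00 f && Sigma00 g
  | FExLt x t f | FAllLt x t f => (x \notin tvars t) && Sigma00 f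
  | FEx _ _ | FAll _ _ | FExSet _ _ | FAllSet _ _ => false
  end.

Definition Sigma02 (f : formula) : bool :=
  match f with FEx _ (FAll _ g) => Sigma00 g | _ => false end.

Fixpoint term_num (t : term) : nat :=
  match t with
  | TVar x => npair 0 x
  | TZero => npair 1 0
  | TOne => npair 2 0
  | TAdd s t => npair 3 (npair (term_num s) (term_num t))
  | TMul s t => npair 4 (npair (term_num s) (term_num t))
  end.

Fixpoint formula_num (f : formula) : nat :=
  match f with
  | FEq s t => npair 0 (npair (term_num s) (term_num t))
  | FLt s t => npair 1 (npair (term_num s) (term_num t))
  | FMem t Z => npair 2 (npair (term_num t) Z)
  | FNot f => npair 3 (formula_num f)
  | FAnd f g => npair 4 (npair (formula_num f) (formula_num g))
  | FOr f g => npair 5 (npair (formula_num f) (formula_num g))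
  | FImp f g => npair 6 (npair (formula_num f) (formula_num g))
  | FExLt x t f => npair 7 (npair x (npair (term_num t) (formula_num f)))
  | FAllLt x t f => npair 8 (npair x (npair (term_num t) (formula_num f)))
  | FEx x f => npair 9 (npair x (formula_num f))
  | FAll x f => npair 10 (npair x (formula_num f))
  | FExSet Z f => npair 11 (npair Z (formula_num f))
  | FAllSet Z f => npair 12 (npair Z (formula_num f))
  end.

Lemma term_num_inj : injective term_num.
Proof.
elim=> [x|||s IHs t IHt|s IHs t IHt] [x'|||s' t'|s' t'] /npair_inj[] // _.
- by move=> ->.
- by case/npair_inj => /IHs -> /IHt ->.
- by case/npair_inj => /IHs -> /IHt ->.
Qed.

Lemma formula_num_inj : injective formula_num.
Proof.
elim=> [s t|s t|t Z|f IHf|f IHf g IHg|f IHf g IHg|f IHf g IHg|x t f IHf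
  |x t f IHf|x f IHf|x f IHf|Z f IHf|Z f IHf]
  [s' t'|s' t'|t' Z'|f'|f' g'|f' g'|f' g'|x' t' f'|x' t' f'|x' f'|x' f'|Z' f'
  |Z' f'] /npair_inj[] // _.
- by case/npair_inj => /term_num_inj -> /term_num_inj ->.
- by case/npair_inj => /term_num_inj -> /term_num_inj ->.
- by case/npair_inj => /term_num_inj -> ->.
- by move=> /IHf ->.
- by case/npair_inj => /IHf -> /IHg ->.
- by case/npair_inj => /IHf -> /IHg ->.
- by case/npair_inj => /IHf -> /IHg ->.
- by case/npair_inj => -> /npair_inj[/term_num_inj -> /IHf ->].
- by case/npair_inj => -> /npair_inj[/term_num_inj -> /IHf ->].
- by case/npair_inj => -> /IHf ->.
- by case/npair_inj => -> /IHf ->.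
- by case/npair_inj => -> /IHf ->.
- by case/npair_inj => -> /IHf ->.
Qed.

Definition operator (f : formula) (A X : set nat) : set nat :=
  [set n | sat (update (fun=> 0) var_n n)
               (update (update (fun=> set0) var_X X) var_Y A) f].

(* [X] codes the pair of [A] and the Goedel number of [f]; a number [e] is
   identified with the set {e}. *)
Definition FP_input (X A : set nat) (f : formula) : Prop :=
  [/\ X_positive f, Sigma02 f & X = join A [set formula_num f]].

Lemma FP_inputs_nonempty : [set X | exists A f, FP_input X A f] !=set0.
Proof.
pose f := FEx 0 (FAll 1 (FEq TZero TZero)).
by exists (join set0 [set formula_num f]), set0, f.
Qed.

Definition FP_Sigma02 : problem :=
  @Problem
    [set X | exists A f, FP_input X A f]
    (fun X => [set W | exists A f, FP_input X A f /\ operator f A W = W])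
    FP_inputs_nonempty.

(* Linear orders are given by their reflexive order relation [lo_le L] on the
   field [lo_field L]. *)
Definition lo_le (L : set nat) (i j : nat) : Prop := L (npair i j).
Definition lo_lt (L : set nat) (i j : nat) : Prop := lo_le L i j /\ i <> j.
Definition lo_field (L : set nat) : set nat :=
  [set i | exists j, lo_le L i j \/ lo_le L j i].

Definition linear_order (L : set nat) : Prop :=
  [/\ forall i, lo_field L i -> lo_le L i i,
      forall i j, lo_le L i j -> lo_le L j i -> i = j,
      forall i j k, lo_le L i j -> lo_le L j k -> lo_le L i k &
      forall i j, lo_field L i -> lo_field L j -> lo_le L i j \/ lo_le L j i].

Definition lo_min (L : set nat) (i : nat) : Prop :=
  lo_field L i /\ forall j, lo_field L j -> lo_le L i j.

(* The sequence of the entries of [X] with index below [i]. *)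
Definition below (L X : set nat) (i : nat) : set nat :=
  [set m | lo_lt L (fstn m) i /\ X m].

Definition jump_hierarchy (L A X : set nat) : Prop :=
  (forall m, X m -> lo_field L (fstn m)) /\
  forall i, lo_field L i ->
    (lo_min L i -> column X i = A) /\
    (~ lo_min L i -> column X i = jump (below L X i)).

Definition descending_seq (L S : set nat) : Prop :=
  exists f : nat -> nat, (forall n, lo_lt L (f n.+1) (f n)) /\ S = graph f.

Definition ATR2_input (X L A : set nat) : Prop :=
  linear_order L /\ X = join L A.

Lemma ATR2_inputs_nonempty : [set X | exists L A, ATR2_input X L A] !=set0.
Proof.
exists (join set0 set0), set0, set0; split=> //.
by split=> // i; [case=> j [] | move=> j [k []]].
Qed.

Definition ATR2 : problem :=
  @Problem
    [set X | exists L A, ATR2_input X L A]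
    (fun X => [set Y | exists L A, ATR2_input X L A /\
                         (jump_hierarchy L A Y \/ descending_seq L Y)])
    ATR2_inputs_nonempty.

(* Main.v *)
From mathcomp Require Import all_boot boolp classical_sets zify.
From Stdlib Require Cantor.
Require Import Defs.

Set Implicit Arguments.
Unset Strict Implicit.
Unset Printing Implicit Defensive.

Local Open Scope classical_set_scope.

(** Why the theorem holds.  Fix a positive [Sigma02] operator that compares
    ranks: a fixed point of [compare_formula] at a relation R is a relation V
    with V(a,b) iff some b' R b satisfies V(a',b') for all a' R a.  As soon as
    one of a, b lies in the well-founded part of R, this forces V(a,b) to say
    that a has smaller rank than b ([comparison_wf_ill], [comparison_ill_wf]);
    when both are ill-founded V(a,b) is arbitrary.  Suppose that Phi and Psi
    reduce FP to ATR_2, and let L(A) be the linear order that Phi computes from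
    the relation A.

    Diagonalization makes L(A) ill-founded.  Let A contain two trees such that
    tree i has a path iff, for some jump hierarchy along L(A), Psi answers i to
    the question whether the root of tree 1 has smaller rank than the root of
    tree 0.  This condition on A is analytic, hence is the existence of a path
    through a tree whose level n depends on A below n only, and so a recursion
    solves the circular definition ([guarded_fixpoint]).  If L(A) were
    well-founded, it would have exactly one jump hierarchy; Psi would give
    exactly one answer i, exactly the tree i would be ill-founded, and the
    answer i would be wrong ([diagonal_ill_founded]).

    So Psi has to work from descending sequences, which cannot take decisions
    back.  The construction leaves room for a parameter x, a set of numbers on
    which A depends continuously: two further points of A are compared
    according to whether x is bounded ([comparison_bounded]).  A descending
    sequence of L(x) decides this question on a finite part, with last element
    p say.  For x' close to x that finite part still descends in L(x'), and if
    the answer for x' is different then no descending sequence of L(x') can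
    start below p.  A limit of finite sets x_n, with decision points p_n, then
    gives a contradiction ([no_decision_of_boundedness]): the limit y is
    unbounded and decides so at a point q; going back to a finite x_n close to
    y, there is descent below p_n but not below q, hence q < p_n; for y there is
    descent below q, hence below p_n, where x_n had decided that the set is
    bounded.

    Computability enters only through continuity of oracle computations
    ([eval_use]) and the Borel complexity of halting ([borel_eval]). *)

(** * Descending sequences *)

Definition descends (T : Type) (R : T -> T -> Prop) (f : nat -> T) : Prop :=
  forall n, R (f n.+1) (f n).

Lemma descends_notAcc (T : Type) (R : T -> T -> Prop) (f : nat -> T) :
  descends R f -> ~ Acc R (f 0).
Proof.
move=> fR; suff no_acc a : Acc R a -> forall n, f n <> a by move/no_acc/(_ 0).
elim=> {}a _ IH n fn; apply: (IH (f n.+1) _ n.+1 erefl); rewrite -fn; exact: fR.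
Qed.

Lemma notAcc_pred (T : Type) (R : T -> T -> Prop) (a : T) :
  ~ Acc R a -> exists2 b, R b a & ~ Acc R b.
Proof.
move=> na; apply: contrapT => no; apply: na; constructor => b Rba.
by apply: contrapT => nb; apply: no; exists b.
Qed.

Lemma notAcc_descends (T : Type) (R : T -> T -> Prop) (a : T) :
  ~ Acc R a -> exists2 f, f 0 = a & descends R f.
Proof.
move=> na.
have step b : exists c, ~ Acc R b -> R c b /\ ~ Acc R c.
  case: (pselect (Acc R b)) => [accb|nb]; first by exists b.
  by have [c ? ?] := notAcc_pred nb; exists c.
have [g gP] := choice step.
exists (fun n => iter n g a) => // n /=.
have : ~ Acc R (iter n g a) by elim: n => //= n /gP[].
by move/gP => [].
Qed.

(** * Finite information about oracles *)

Definition agree (m : nat) (O O' : set nat) : Prop :=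
  forall k, k < m -> (O k <-> O' k).

Lemma agree_refl m O : agree m O O.
Proof. by []. Qed.

Lemma agree_sym m O O' : agree m O O' -> agree m O' O.
Proof. by move=> h k /h[]. Qed.

Lemma agreeW m m' O O' : m <= m' -> agree m' O O' -> agree m O O'.
Proof. by move=> mm' h k km; apply: h; apply: leq_trans mm'. Qed.

Lemma agree_join m A A' B B' :
  agree m A A' -> agree m B B' -> agree m (join A B) (join A' B').
Proof. by move=> hA hB k km; rewrite /join/=; case: ifP => _; [apply: hB|apply: hA]; lia. Qed.

(** [P] is a neighbourhood of [O] in Cantor space. *)
Definition locally (O : set nat) (P : set nat -> Prop) : Prop :=
  exists m, forall O', agree m O O' -> P O'.

Lemma locallyI O (P Q : set nat -> Prop) :
  locally O P -> locally O Q -> locally O (fun O' => P O' /\ Q O').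
Proof.
move=> [m hm] [n hn]; exists (maxn m n) => O' h.
by split; [apply: hm|apply: hn]; apply: agreeW h; lia.
Qed.

Lemma locally_all_lt O (P : nat -> set nat -> Prop) n :
  (forall k, k < n -> locally O (P k)) ->
  locally O (fun O' => forall k, k < n -> P k O').
Proof.
elim: n => [|n IH] h; first by exists 0.
have [|m hm] := locallyI (IH _) (h n (ltnSn n)); first by move=> k kn; apply: h; lia.
exists m => O' /hm[h1 h2] k; rewrite ltnS leq_eqVlt => /orP[/eqP->//|]; exact: h1.
Qed.

Lemma locallyW O (P Q : set nat -> Prop) :
  (forall O', P O' -> Q O') -> locally O P -> locally O Q.
Proof. by move=> PQ [m hm]; exists m => O' /hm/PQ. Qed.

(** The use principle: a halting computation asks finitely many questions. *)
Lemma eval_use O c x y : eval O c x y -> locally O (fun O' => eval O' c x y).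
Proof.
elim: c x y => [||||| c IHc d IHd | c IHc d IHd | c IHc d IHd | c IHc] x y /=;
  try by exists 0.
- by case=> -[h1 h2]; exists x.+1 => O' /(_ x (ltnSn x)) h; [left|right];
    split=> //; tauto.
- move=> [u [v [/IHc hu /IHd hv e]]]; apply: locallyW (locallyI hu hv).
  by move=> O' [? ?]; exists u, v.
- move=> [z /IHd hz /IHc hy]; apply: locallyW (locallyI hz hy).
  by move=> O' [? ?]; exists z.
- elim: (sndn x) y => [|n IHn] y; first exact: IHc.
  move=> [s /IHn hs /IHd hy]; apply: locallyW (locallyI hs hy).
  by move=> O' [? ?]; exists s.
- move=> [/IHc h0 hk]; apply: locallyI h0 _.
  apply: locally_all_lt => k /hk[r /IHc]; apply: locallyW.
  by move=> O' ?; exists r.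
Qed.

Lemma eval_det O c x y y' : eval O c x y -> eval O c x y' -> y = y'.
Proof.
elim: c x y y' => [||||| c IHc d IHd | c IHc d IHd | c IHc d IHd | c IHc] x y y' /=;
  try by move=> -> ->.
- by case=> -[? ->] [] [? ->].
- move=> [u [v [hu hv ->]]] [u' [v' [hu' hv' ->]]].
  by rewrite (IHc _ _ _ hu hu') (IHd _ _ _ hv hv').
- by move=> [z hz hy] [z' hz']; rewrite -(IHd _ _ _ hz hz'); apply: IHc.
- elim: (sndn x) y y' => [|n IHn] y y'; first exact: IHc.
  by move=> [s hs hy] [s' hs']; rewrite -(IHn _ _ hs hs'); apply: IHd.
- move=> [h0 hk] [h0' hk']; case: (ltngtP y y') => // lt.
  + by have [r hr] := hk' _ lt; have := IHc _ _ _ h0 hr.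
  + by have [r hr] := hk _ lt; have := IHc _ _ _ h0' hr.
Qed.

Lemma computes_det c X Z Z' : computes c X Z -> computes c X Z' -> Z = Z'.
Proof.
move=> h h'; apply/seteqP; split=> n;
  case: (h n) (h' n) => -[hz e] [] [hz' e'] // _; have := eval_det e e'; lia.
Qed.

Lemma computes_eval1 c X Z n : computes c X Z -> Z n -> eval X c n 1.
Proof. by move=> /(_ n)[[]|[]]. Qed.

Lemma computes_eval0 c X Z n : computes c X Z -> ~ Z n -> eval X c n 0.
Proof. by move=> /(_ n)[[]|[]]. Qed.

Lemma computes_evalE c X Z n v : computes c X Z -> eval X c n v -> (Z n <-> v = 1).
Proof.
move=> /(_ n)[[hz e]|[hz e]] /(eval_det e) <-; by split.
Qed.

Lemma computes_use c X Z n :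
  computes c X Z -> locally X (fun X' => forall Z', computes c X' Z' -> (Z n <-> Z' n)).
Proof.
move=> h; case: (h n) => -[hz /eval_use]; apply: locallyW => X' e Z' h';
  have := computes_evalE h' e; intuition lia.
Qed.

(** * Pairs and sequences of sets *)

Definition evens (U : set nat) : set nat := [set n | U n.*2].
Definition odds (U : set nat) : set nat := [set n | U n.*2.+1].

Lemma evens_join A B : evens (join A B) = A.
Proof. by apply/seteqP; split=> n; rewrite /evens /join /= odd_double doubleK. Qed.

Lemma odds_join A B : odds (join A B) = B.
Proof. by apply/seteqP; split=> n; rewrite /odds /join /= odd_double /= uphalf_double. Qed.

Lemma join_inj A B A' B' : join A B = join A' B' -> A = A' /\ B = B'.
Proof.
move=> e; move: (evens_join A B) (odds_join A B).
by rewrite e evens_join odds_join.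
Qed.

Lemma npair_ge i j : i <= npair i j.
Proof. by have := Cantor.to_nat_non_decreasing i j; rewrite /npair; lia. Qed.

Lemma fstnK i j : fstn (npair i j) = i.
Proof. by rewrite /fstn /npair Cantor.cancel_of_to. Qed.

Lemma sndnK i j : sndn (npair i j) = j.
Proof. by rewrite /sndn /npair Cantor.cancel_of_to. Qed.

Lemma npairK n : npair (fstn n) (sndn n) = n.
Proof. by rewrite /fstn /sndn /npair -surjective_pairing Cantor.cancel_to_of. Qed.

(** * Borel and analytic classes of oracles *)

(** The Borel sets of Cantor space, generated by the clopen subbasis.  Every
    arithmetical condition is seen to be Borel by following its syntax, and
    [borel_analytic2] then supplies trees for it. *)
Inductive borel : (set nat -> Prop) -> Prop :=
  | borel_mem n : borel (fun O => O n)
  | borel_not P : borel P -> borel (fun O => ~ P O)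
  | borel_all (P : nat -> set nat -> Prop) :
      (forall n, borel (P n)) -> borel (fun O => forall n, P n O).

Lemma borel_ext (P Q : set nat -> Prop) :
  (forall O, Q O <-> P O) -> borel P -> borel Q.
Proof. by move=> e; have -> // : Q = P by apply: funext => O; apply: propext. Qed.

Lemma borel_ex (P : nat -> set nat -> Prop) :
  (forall n, borel (P n)) -> borel (fun O => exists n, P n O).
Proof.
move=> h; apply: borel_ext (borel_not (borel_all (fun n => borel_not (h n)))) => O.
split=> [[n hn] /(_ n)//|no]; apply: contrapT => no'; apply: no => n hn.
by apply: no'; exists n.
Qed.

Lemma borelI (P Q : set nat -> Prop) :
  borel P -> borel Q -> borel (fun O => P O /\ Q O).
Proof.
move=> hP hQ.
have h n : borel (if n == 0 then P else Q) by case: n.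
apply: borel_ext (borel_all h) => O; split=> [[? ?] [|n]//|hh].
by split; [exact: (hh 0)|exact: (hh 1)].
Qed.

Lemma borelU (P Q : set nat -> Prop) :
  borel P -> borel Q -> borel (fun O => P O \/ Q O).
Proof.
move=> hP hQ; apply: borel_ext (borel_not (borelI (borel_not hP) (borel_not hQ))) => O.
split; first tauto.
by move=> no; case: (pselect (P O)); case: (pselect (Q O)); tauto.
Qed.

Lemma borel_imp (P Q : set nat -> Prop) :
  borel P -> borel Q -> borel (fun O => P O -> Q O).
Proof.
move=> hP hQ; apply: borel_ext (borelU (borel_not hP) hQ) => O.
by case: (pselect (P O)); tauto.
Qed.

Lemma borel_iff (P Q : set nat -> Prop) :
  borel P -> borel Q -> borel (fun O => P O <-> Q O).
Proof. by move=> hP hQ; apply: borelI; apply: borel_imp. Qed.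

Lemma borel_const (Q : Prop) : borel (fun=> Q).
Proof.
have hT : borel (fun=> True).
  by apply: borel_ext (borel_imp (borel_mem 0) (borel_mem 0)) => O; tauto.
case: (pselect Q) => q; first by apply: borel_ext hT.
by apply: borel_ext (borel_not hT); tauto.
Qed.

Lemma borel_ex2 (P Q : nat -> set nat -> Prop) :
  (forall n, borel (P n)) -> (forall n, borel (Q n)) ->
  borel (fun O => exists2 n, P n O & Q n O).
Proof.
move=> hP hQ; apply: borel_ext (borel_ex (fun n => borelI (hP n) (hQ n))) => O.
by split=> -[n]; [exists n|move=> []; exists n].
Qed.

Definition borel_map (F : set nat -> set nat) : Prop :=
  forall n, borel (fun O => F O n).

Lemma borel_comp P F : borel P -> borel_map F -> borel (fun O => P (F O)).
Proof.
move=> hP hF; elim: hP => [n|Q _ IH|Q _ IH]; first exact: hF.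
  exact: borel_not.
exact: borel_all.
Qed.

Lemma borel_map_eq F G :
  borel_map F -> borel_map G -> borel (fun O => F O = G O).
Proof.
move=> hF hG; apply: borel_ext (borel_all (fun n => borel_iff (hF n) (hG n))) => O.
split=> [->//|h]; apply/seteqP; by split=> n /(h n).
Qed.

Lemma borel_map_join F G :
  borel_map F -> borel_map G -> borel_map (fun O => join (F O) (G O)).
Proof. by move=> hF hG n; rewrite /join /=; case: (odd n); [exact: hG|exact: hF]. Qed.

Lemma borel_eval c x y : borel (fun O => eval O c x y).
Proof.
elim: c x y => [||||| c IHc d IHd | c IHc d IHd | c IHc d IHd | c IHc] x y /=;
  try exact: borel_const.
- apply: borelU; apply: borelI (borel_const _); first exact: borel_mem.
  exact: borel_not (borel_mem x).
- apply: borel_ex => u; apply: borel_ex => v.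
  apply: borel_ext (borelI (IHc x u) (borelI (IHd x v) (borel_const (y = npair u v)))).
  by move=> O; split=> [[]|[? []]].
- exact: borel_ex2.
- elim: (sndn x) y => [|n IHn] y; [exact: IHc|exact: borel_ex2].
- apply: borelI (IHc _ _) _; apply: borel_all => k; apply: borel_imp (borel_const _) _.
  exact: borel_ex.
Qed.

Lemma borel_computes c F G :
  borel_map F -> borel_map G -> borel (fun O => computes c (F O) (G O)).
Proof.
move=> hF hG; apply: borel_all => n.
have heval v : borel (fun O => eval (F O) c n v).
  exact: borel_comp (borel_eval c n v) hF.
by apply: borelU; apply: borelI => //; apply: borel_not.
Qed.

(** Membership of [n] in a jump quantifies over programs, but at most one
    program has the code [n]. *)
Lemma borel_map_jump F : borel_map F -> borel_map (fun O => jump (F O)).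
Proof.
move=> hF n; case: (pselect (exists c, n = code_num c)) => [[c nc]|no]; last first.
  apply: borel_ext (borel_const False) => O.
  by split=> // -[c [nc _]]; apply: no; exists c.
apply: borel_ext (borel_ex (fun y => borel_comp (borel_eval c n y) hF)) => O.
split=> [[c' [nc' h]]|h]; last by exists c.
by rewrite (code_num_inj (etrans (esym nc) nc')).
Qed.

Lemma borel_lo_field F i : borel_map F -> borel (fun O => lo_field (F O) i).
Proof. by move=> hF; apply: borel_ex => j; apply: borelU; exact: hF. Qed.

Lemma borel_lo_min F i : borel_map F -> borel (fun O => lo_min (F O) i).
Proof.
move=> hF; apply: borelI; first exact: borel_lo_field.
by apply: borel_all => j; apply: borel_imp; [exact: borel_lo_field|exact: hF].
Qed.

Lemma borel_jump_hierarchy F G H : borel_map F -> borel_map G -> borel_map H ->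
  borel (fun O => jump_hierarchy (F O) (G O) (H O)).
Proof.
move=> hF hG hH; apply: borelI.
  by apply: borel_all => m; apply: borel_imp; [exact: hH|exact: borel_lo_field].
have hcol i : borel_map (fun O => column (H O) i) by move=> n; exact: hH.
have hbelow i : borel_map (fun O => below (F O) (H O) i).
  move=> m; apply: borelI; last exact: hH.
  by apply: borelI; [exact: hF|exact: borel_const].
apply: borel_all => i; apply: borel_imp; first exact: borel_lo_field.
apply: borelI; apply: borel_imp.
- exact: borel_lo_min.
- exact: borel_map_eq.
- by apply: borel_not; exact: borel_lo_min.
- by apply: borel_map_eq => //; exact: borel_map_jump.
Qed.

(** Up to length [m], the pair of [O] and [z] looks like a member of [C]: this
    is the tree of a closed set, presented through the set. *)
Definition near (C : set nat -> (nat -> nat) -> Prop) (m : nat)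
    (O : set nat) (z : nat -> nat) : Prop :=
  exists O' z', [/\ agree m O O', forall k, k < m -> z k = z' k & C O' z'].

Definition closed (C : set nat -> (nat -> nat) -> Prop) : Prop :=
  forall O z, (forall m, near C m O z) -> C O z.

Lemma nearW C m m' O z : m <= m' -> near C m' O z -> near C m O z.
Proof.
move=> mm' [O' [z' [hO hz hC]]]; exists O', z'; split=> //; first exact: agreeW hO.
by move=> k km; apply: hz; lia.
Qed.

Definition analytic (P : set nat -> Prop) : Prop :=
  exists C, closed C /\ forall O, P O <-> exists z, C O z.

Lemma analytic_ext (P Q : set nat -> Prop) :
  (forall O, Q O <-> P O) -> analytic P -> analytic Q.
Proof. by move=> e; have -> // : Q = P by apply: funext => O; apply: propext. Qed.

Lemma bound_below (g : nat -> nat) n : exists m, forall k, k < n -> g k < m.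
Proof.
elim: n => [|n [m hm]]; first by exists 0.
exists (maxn m (g n).+1) => k; rewrite ltnS leq_eqVlt => /orP[/eqP->|/hm]; lia.
Qed.

(** Witnesses for all [n] are merged into one, the [n]-th being its section at
    [n]; a finite part of that section involves a finite part of the whole. *)
Lemma analytic_all (P : nat -> set nat -> Prop) :
  (forall n, analytic (P n)) -> analytic (fun O => forall n, P n O).
Proof.
move=> h.
have [C hC] := choice h.
exists (fun O z => forall n, C n O (fun k => z (npair n k))); split.
  move=> O z near_z n; apply: (hC n).1 => m.
  have [m' hm'] := bound_below (npair n) m.
  have [O' [z' [hO hz hz']]] := near_z (maxn m m').
  exists O', (fun k => z' (npair n k)); split=> //; first by apply: agreeW hO; lia.
  by move=> k /hm' km; apply: hz; lia.
move=> O; split=> [hP|[z hz] n].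
  have [z hz] := choice (fun n => (((hC n).2 O).1 (hP n))).
  exists (fun j => z (fstn j) (sndn j)) => n.
  suff -> : (fun k => z (fstn (npair n k)) (sndn (npair n k))) = z n by [].
  by apply: funext => k; rewrite fstnK sndnK.
by apply/(hC n).2; exists (fun k => z (npair n k)).
Qed.

(** The first value of the witness announces [n], so that the union stays
    closed. *)
Lemma analytic_ex (P : nat -> set nat -> Prop) :
  (forall n, analytic (P n)) -> analytic (fun O => exists n, P n O).
Proof.
move=> h.
have [C hC] := choice h.
exists (fun O z => C (z 0) O (fun k => z k.+1)); split.
  move=> O z near_z; apply: (hC _).1 => m.
  have [O' [z' [hO hz hz']]] := near_z m.+1.
  exists O', (fun k => z' k.+1); split; first by apply: agreeW hO.
    by move=> k km; apply: hz.
  by rewrite hz.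
move=> O; split=> [[n /(hC n).2[z hz]]|[z hz]].
  by exists (fun k => if k is k'.+1 then z k' else n).
by exists (z 0); apply/(hC _).2; exists (fun k => z k.+1).
Qed.

(** Complements are carried along because the class of analytic sets is not
    closed under complementation. *)
Lemma borel_analytic2 P : borel P -> analytic P /\ analytic (fun O => ~ P O).
Proof.
elim=> {P} [n|P _ [hP hnP]|P _ IH].
- split; [exists (fun O _ => O n)|exists (fun O _ => ~ O n)]; split.
  + by move=> O z /(_ n.+1)[O' [z' [/(_ n (ltnSn n)) h _ ?]]]; apply/h.
  + by move=> O; split=> [?|[]//]; exists id.
  + by move=> O z /(_ n.+1)[O' [z' [/(_ n (ltnSn n)) h _ ?]]] /h.
  + by move=> O; split=> [?|[]//]; exists id.
- split=> //; apply: analytic_ext hP => O; split=> [|?]; last exact.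
  exact: contrapT.
- split; first by apply: analytic_all => n; case: (IH n).
  have := analytic_ex (fun n => (IH n).2); apply: analytic_ext => O.
  split=> [no|[n hn] /(_ n)//]; apply: contrapT => no'; apply: no => n.
  by apply: contrapT => hn; apply: no'; exists n.
Qed.

(** The set quantifier is absorbed by the witness: zeros at
    even places mark the members of [U], odd places hold a witness for [P]. *)
Lemma analytic_proj P : borel P -> analytic (fun O => exists U, P (join O U)).
Proof.
move=> /borel_analytic2[[C [hC PC]] _].
pose S (z : nat -> nat) : set nat := [set k | z k.*2 = 0].
exists (fun O z => C (join O (S z)) (fun k => z k.*2.+1)); split.
  move=> O z near_z; apply: hC => m.
  have [O' [z' [hO hz hz']]] := near_z m.*2.+1.
  exists (join O' (S z')), (fun k => z' k.*2.+1); split=> //.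
    apply: agree_join; first by apply: agreeW hO; lia.
    by move=> k km; rewrite /S /= hz //; lia.
  by move=> k km; apply: hz; lia.
move=> O; split=> [[U /PC[z hz]]|[z hz]]; last by exists (S z); apply/PC; exists (fun k => z k.*2.+1).
exists (fun k => if odd k then z k./2 else ~~ `[< U k./2 >]).
have -> : S (fun k => if odd k then z k./2 else ~~ `[< U k./2 >]) = U.
  apply/seteqP; split=> k; rewrite /S /= odd_double doubleK.
    by case: asboolP.
  by case: asboolP.
suff -> : (fun k => if odd k.*2.+1 then z (k.*2.+1)./2 else ~~ `[< U (k.*2.+1)./2 >]) = z by [].
by apply: funext => k; rewrite /= odd_double /= uphalf_double.
Qed.

(** * Jump hierarchies along well-founded orders *)

Lemma columnE Y m : column Y (fstn m) (sndn m) = Y m.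
Proof. by rewrite /column /= npairK. Qed.

Lemma jump_hierarchy_unique L A Y Y' :
  well_founded (lo_lt L) -> jump_hierarchy L A Y -> jump_hierarchy L A Y' -> Y = Y'.
Proof.
move=> wfL [sY hY] [sY' hY'].
suff col i : column Y i = column Y' i.
  by apply/seteqP; split=> m; rewrite -(columnE Y) -(columnE Y') col.
elim/(well_founded_ind wfL): i => i IH.
case: (pselect (lo_field L i)) => [Li|nLi]; last first.
  by apply/seteqP; split=> n => [/sY|/sY']; rewrite fstnK.
have [mY nY] := hY i Li; have [mY' nY'] := hY' i Li.
case: (pselect (lo_min L i)) => [mi|nmi]; first by rewrite mY // mY'.
rewrite nY // nY' //; congr jump.
by apply/seteqP; split=> m [lt Ym]; split=> //; move: Ym;
  rewrite -(columnE Y) -(columnE Y') (IH _ lt).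
Qed.

(** Recursion along [L].  The recursive calls are available only below [i], and
    the existential quantifier over the proof of that fact expresses [below]. *)
Lemma jump_hierarchy_exists L A :
  well_founded (lo_lt L) -> exists Y, jump_hierarchy L A Y.
Proof.
move=> wfL.
pose F i (rec : forall j, lo_lt L j i -> set nat) : set nat :=
  [set n | lo_field L i /\
     ((lo_min L i /\ A n) \/
      (~ lo_min L i /\
       jump [set m | exists h : lo_lt L (fstn m) i, rec _ h (sndn m)] n))].
pose Y := [set m | Fix wfL (fun=> set nat) F (fstn m) (sndn m)].
have colE i : column Y i = F i (fun j _ => column Y j).
  have colY j : column Y j = Fix wfL (fun=> set nat) F j.
    by apply/seteqP; split=> n; rewrite /column /Y /= fstnK sndnK.
  rewrite colY Fix_eq; last first.
    move=> k f g fg; have -> // : f = g.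
    by apply: functional_extensionality_dep => j; apply: functional_extensionality_dep.
  by congr F; apply: functional_extensionality_dep => j; apply: funext => _; rewrite colY.
exists Y; split.
  move=> m; rewrite -{1}(npairK m) => h.
  by have : column Y (fstn m) (sndn m) by []; rewrite colE => -[].
move=> i Li; rewrite colE; split=> mi.
  by apply/seteqP; split=> n; [move=> [_ [[]|[]]]|split=> //; left].
have -> : below L Y i = [set m | exists _ : lo_lt L (fstn m) i, column Y (fstn m) (sndn m)].
  by apply/seteqP; split=> m [lt]; rewrite /column /= npairK; split.
by apply/seteqP; split=> n; [move=> [_ [[]|[]]]|split=> //; right].
Qed.

(** * Comparing ranks by fixed points *)

(** An injective pairing that is a polynomial, hence a term of arithmetic; the
    Cantor pairing would need a division by two. *)
Definition sqpair (a b : nat) : nat := (a + b) * (a + b) + a.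

(** [(a + b)^2 <= sqpair a b < (a + b + 1)^2], so the sum can be read off. *)
Lemma sqpair_inj a b a' b' : sqpair a b = sqpair a' b' -> a = a' /\ b = b'.
Proof.
rewrite /sqpair => e.
have ab : a + b = a' + b' by nia.
by move: e; rewrite ab; lia.
Qed.

Lemma sqpair_ge a b : a <= sqpair a b /\ b <= sqpair a b.
Proof. by rewrite /sqpair; split; nia. Qed.

Lemma sqpair_gt a b : 0 < b -> a < sqpair a b.
Proof. by rewrite /sqpair; nia. Qed.

Definition sqpair_term (x y : nat) : term :=
  let s := TAdd (TVar x) (TVar y) in TAdd (TMul s s) (TVar x).

(** Variables 1, 2, 3, 4 stand for b', a', a, b in [operator_compareE].  Decoding
    [n] into a and b takes bounded quantifiers; they may stand inside the
    unbounded ones because a and b are unique. *)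
Definition compare_formula : formula :=
  FEx 1 (FAll 2
    (FExLt 3 (TAdd (TVar var_n) TOne) (FExLt 4 (TAdd (TVar var_n) TOne)
      (FAnd (FEq (TVar var_n) (sqpair_term 3 4))
        (FAnd (FMem (sqpair_term 1 4) var_Y)
          (FOr (FNot (FMem (sqpair_term 2 3) var_Y))
               (FMem (sqpair_term 2 1) var_X))))))).

Lemma operator_compareE A W a b :
  operator compare_formula A W (sqpair a b) <->
  exists2 b', A (sqpair b' b) & forall a', A (sqpair a' a) -> W (sqpair a' b').
Proof.
rewrite /operator /= /update /=; split.
  move=> [b' h]; exists b'.
    by have [a0 _ [b0 _ [/sqpair_inj[_ ->] []]]] := h 0.
  by move=> a' Aa'; have [a0 _ [b0 _ [/sqpair_inj[ea eb] [_]]]] := h a'; rewrite -ea; case.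
move=> [b' Ab h]; exists b' => a'; exists a; first by have [] := sqpair_ge a b; lia.
exists b; first by have [] := sqpair_ge a b; lia.
by do 2!split=> //; case: (pselect (A (sqpair a' a))); [right; apply: h|left].
Qed.

Definition FP_instance (A : set nat) : set nat :=
  join A [set formula_num compare_formula].

Lemma FP_instance_input A : FP_input (FP_instance A) A compare_formula.
Proof. by []. Qed.

Lemma agree_FP_instance m A A' :
  agree m A A' -> agree m (FP_instance A) (FP_instance A').
Proof. by move=> h; apply: agree_join. Qed.

Definition comparison (T : Type) (R V : T -> T -> Prop) : Prop :=
  forall a b, V a b <-> exists2 b', R b' b & forall a', R a' a -> V a' b'.

(** Read [V a b] as: the rank of [a] is smaller than that of [b].  An ill-founded
    [b] always has an ill-founded predecessor to continue with, while the
    induction on [a] comes to an end. *)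
Lemma comparison_wf_ill (T : Type) (R V : T -> T -> Prop) a b :
  comparison R V -> Acc R a -> ~ Acc R b -> V a b.
Proof.
move=> cmp acca; elim: acca b => {}a _ IH b nb; have [b' Rb nb'] := notAcc_pred nb.
by apply/cmp; exists b' => // a' /IH; apply.
Qed.

Lemma comparison_ill_wf (T : Type) (R V : T -> T -> Prop) a b :
  comparison R V -> ~ Acc R a -> Acc R b -> ~ V a b.
Proof.
move=> cmp + accb; elim: accb a => {}b _ IH a na /cmp[b' Rb h]; have [a' Ra na'] := notAcc_pred na.
exact: (IH _ Rb _ na' (h _ Ra)).
Qed.

(** * The input relations *)

(** The points of the input relations.  The numbers [Chain m] are ordered as
    usual; [LStar] lies above the members of [x] and [RStar] above all numbers, so
    [LStar] has smaller rank than [RStar] iff [x] is bounded.  [Branch i t] is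
    the node [t] of tree [i]. *)
Inductive node : Type :=
  | Chain of nat
  | LStar
  | RStar
  | Branch of bool & seq nat.

(** The number of a branch node dominates its length, so that an edge from it
    may depend on the oracle up to that length. *)
Definition node_num (u : node) : nat :=
  match u with
  | Chain k => sqpair 0 k
  | LStar => sqpair 1 0
  | RStar => sqpair 2 0
  | Branch i t => sqpair (3 + i) (sqpair (size t) (pickle t))
  end.

Lemma node_num_inj : injective node_num.
Proof.
move=> [k|||i t] [k'|||i' t'] /sqpair_inj[] //=; try by case: i || case: i'.
- by move=> _ ->.
- move=> ei /sqpair_inj[_ /(pcan_inj pickleK) ->].
  by case: i i' ei => -[].
Qed.

Definition bounded (x : set nat) : Prop := exists m, forall k, x k -> k < m.

(** Tree [i] is the tree of attempts to build [z] with [C i A z]; its nodes are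
    tested against the relation [A] that is being defined. *)
Definition edge (C : bool -> set nat -> (nat -> nat) -> Prop) (x A : set nat)
    (u v : node) : Prop :=
  match v with
  | Chain m => exists2 j, u = Chain j & j < m
  | LStar => exists2 k, u = Chain k & x k
  | RStar => exists k, u = Chain k
  | Branch i t => exists2 c, u = Branch i (rcons t c) &
                    near (C i) (size t).+1 A (nth 0 (rcons t c))
  end.

(** Along the chain the comparison is the order of the natural numbers. *)
Lemma comparison_bounded C x A V :
  comparison (edge C x A) V -> V LStar RStar <-> bounded x.
Proof.
move=> cmp.
have chain k m : V (Chain k) (Chain m) <-> k < m.
  elim/ltn_ind: m k => m IH k; split.
    move=> /cmp[u [j -> jm] h]; case: k h => [|k] h; first by lia.
    suff /(IH j jm k) : V (Chain k) (Chain j) by lia.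
    by apply: h; exists k.
  move=> km; apply/cmp; exists (Chain k); first by exists k.
  by move=> u [i -> ik]; apply/IH.
split.
  move=> /cmp[u [m ->] h]; exists m => k xk.
  by apply/chain/h; exists k.
move=> [m xm]; apply/cmp; exists (Chain m); first by exists m.
by move=> u [k -> /xm/chain].
Qed.

Lemma branch_ill C x A i : closed (C i) ->
  ~ Acc (edge C x A) (Branch i [::]) <-> exists z, C i A z.
Proof.
move=> clC; split.
  move=> na; have [f f0 fd] := notAcc_descends na.
  pose z n := if f n.+1 is Branch _ t then last 0 t else 0.
  have step n : f n = Branch i (mkseq z n) ->
      f n.+1 = Branch i (mkseq z n.+1) /\ near (C i) n.+1 A (nth 0 (mkseq z n.+1)).
    move=> fn; move: (fd n); rewrite fn => -[c fn1 hc].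
    have zn : z n = c by rewrite /z fn1 last_rcons.
    by move: hc; rewrite size_mkseq mkseqS zn.
  have fz n : f n = Branch i (mkseq z n) by elim: n => // n /step[].
  exists z; apply: clC => m; apply: (@nearW _ m m.+1) => //.
  have [O' [z' [hO hz hC]]] := (step m (fz m)).2.
  by exists O', z'; split=> // k km; rewrite -hz // nth_mkseq.
move=> [z hz].
suff d : descends (edge C x A) (fun n => Branch i (mkseq z n)).
  exact: (descends_notAcc d).
move=> n; exists (z n); rewrite -mkseqS // size_mkseq.
exists A, z; split=> // k kn.
by rewrite nth_mkseq.
Qed.

Definition edge_set C x A : set nat :=
  [set n | exists u v, n = sqpair (node_num u) (node_num v) /\ edge C x A u v].

Lemma edge_setE C x A u v :
  edge_set C x A (sqpair (node_num u) (node_num v)) <-> edge C x A u v.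
Proof.
split=> [[u' [v' [/sqpair_inj[/node_num_inj -> /node_num_inj ->]]]]//|h].
by exists u, v.
Qed.

Lemma agree_near C m A A' z : agree m A A' -> near C m A z -> near C m A' z.
Proof.
move=> h [O' [z' [hO hz hC]]]; exists O', z'; split=> // k km.
by rewrite -(hO k km) (h k km).
Qed.

(** The code of an edge exceeds every place of [x] and of [A] that the edge
    depends on. *)
Lemma edge_set_guarded C x x' A A' n :
  agree n x x' -> agree n A A' -> edge_set C x A n -> edge_set C x' A' n.
Proof.
move=> hx hA [u [v [en uv]]]; exists u, v; split=> //.
case: v en uv => [m|||i t] en //= [k eu hk]; exists k => //; subst u.
  apply/hx => //; rewrite en /=.
  by apply: leq_ltn_trans (sqpair_gt _ _); first exact: (sqpair_ge 0 k).2.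
apply: agree_near hk; apply: agreeW hA; rewrite en /= -(size_rcons t k).
set s := rcons t k; set v := sqpair _ (sqpair (size t) _).
apply: leq_trans (sqpair_ge _ v).1; apply: leq_trans (sqpair_ge _ _).2.
exact: (sqpair_ge _ _).1.
Qed.

(** Iterating [F x] from any set fixes one more place at each round, and the
    places below [m] involve [x] below [m] only. *)
Lemma guarded_fixpoint (F : set nat -> set nat -> set nat) :
  (forall x x' A A' n, agree n x x' -> agree n A A' -> F x A n -> F x' A' n) ->
  exists G : set nat -> set nat,
    (forall x, G x = F x (G x)) /\
    forall m x x', agree m x x' -> agree m (G x) (G x').
Proof.
move=> hF; pose H x n := iter n (F x) set0.
have HH x m n : m <= n -> agree m (H x m) (H x n).
  elim: m n => [|m IH] [|n] // mn k km /=.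
  by split; apply: hF => //; [|apply: agree_sym]; apply: agreeW (IH n mn); lia.
pose G x : set nat := [set n | H x n.+1 n].
have GH x n : agree n (G x) (H x n) by move=> k kn; apply: HH.
have GE x : G x = F x (G x).
  apply/seteqP; split=> n.
    by apply: hF; last exact: agree_sym.
  by apply: hF.
exists G; split=> // m x x' hx k; elim/ltn_ind: k => k IH km.
have Gk y y' : agree m y y' -> agree k (G y) (G y') -> G y k -> G y' k.
  move=> hy hG; rewrite [in X in X -> _]GE [in X in _ -> X]GE; apply: hF => //.
  by apply: agreeW hy; lia.
have hG : agree k (G x) (G x') by move=> j jk; apply: IH => //; lia.
by split; apply: Gk => //; apply: agree_sym.
Qed.

(** * Continuous families of ill-founded orders *)

Definition ill_below (L : set nat) (p : nat) : Prop :=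
  exists2 f, descends (lo_lt L) f & lo_lt L (f 0) p.

Lemma ill_below_le L p q :
  linear_order L -> lo_le L p q -> ill_below L p -> ill_below L q.
Proof.
move=> [_ anti trans _] pq [f fd [fp nfp]]; exists f => //; split.
  exact: trans pq.
by move=> e; apply: nfp; apply: anti => //; rewrite e.
Qed.

Definition adjoin (x : set nat) (k : nat) : set nat := [set j | x j \/ j = k].

(** Continuously given, always ill-founded orders cannot decide by finite parts
    of their descending sequences whether the parameter is bounded.  Near the
    parameter where a decision point was chosen, descent below it is possible only
    for parameters with the answer decided there.  Of two decision points with
    opposite answers, the one chosen later must therefore lie strictly above the
    earlier one.  The limit parameter breaks this: its own
    decision point lies below those of all late stages, which have descent below
    them for the wrong answer. *)
Lemma no_decision_of_boundedness (L : set nat -> set nat) :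
  (forall x, linear_order (L x)) ->
  (forall x k, locally x (fun x' => L x k <-> L x' k)) ->
  ~ (forall x, exists2 p, ill_below (L x) p &
       locally x (fun x' => ill_below (L x') p -> (bounded x' <-> bounded x))).
Proof.
move=> linL contL decL.
(* From a set [x] and a stage [k], take a decision point [p] and a bound
   [K] on the information that decides at [p], puts [p] into the field, and
   keeps the numbers below [k] that are below [p] there. *)
have step (xk : set nat * nat) : exists pK : nat * nat,
    [/\ xk.2 <= pK.2, ill_below (L xk.1) pK.1 &
        forall x', agree pK.2 xk.1 x' ->
          [/\ ill_below (L x') pK.1 -> (bounded x' <-> bounded xk.1),
              L x' (npair pK.1 pK.1) &
              forall i, i < xk.2 -> L xk.1 (npair i pK.1) -> L x' (npair i pK.1)]].
  case: xk => x k /=; have [p illp decp] := decL x.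
  have Lpp : L x (npair p p).
    have [refl _ _ _] := linL x; have [f _ [fp _]] := illp.
    by apply: refl; exists (f 0); right.
  have contk := locally_all_lt (fun i (_ : i < k) => contL x (npair i p)).
  have [K hK] := locallyI decp (locallyI (contL x (npair p p)) contk).
  exists (p, maxn k K); split=> //=; first by lia.
  move=> x' hx; have [|h1 [h2 h3]] := hK x'; first by apply: agreeW hx; lia.
  by split=> //; [apply/h2|move=> i /h3[]].
have [next nextP] := choice step.
(* Each stage adds to [x] one number beyond the information used so far. *)
pose s := fix s n := if n is n'.+1 then
    (adjoin (s n').1 (next (s n')).2, (next (s n')).2.+1) else (set0, 0).
pose x n := (s n).1; pose k n := (s n).2.
pose p n := (next (s n)).1; pose K n := (next (s n)).2.
have xS n : x n.+1 = adjoin (x n) (K n) by [].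
have kS n : k n.+1 = (K n).+1 by [].
have kK n : k n <= K n by have [] := nextP (s n).
have x_lt n j : x n j -> j < k n.
  elim: n j => // n IH j; rewrite xS kS => -[/IH|->//]; have := kK n; lia.
have n_le_k n : n <= k n by elim: n => // n IH; rewrite kS; have := kK n; lia.
have x_sub m n j : m <= n -> x m j -> x n j.
  elim: n => [|n IH]; first by rewrite leqn0 => /eqP->.
  rewrite leq_eqVlt => /orP[/eqP->//|mn xm]; rewrite xS; left; exact: IH.
have k_mono m n : m <= n -> k m <= k n.
  elim: n => [|n IH]; first by rewrite leqn0 => /eqP->.
  rewrite leq_eqVlt => /orP[/eqP->//|/IH]; rewrite kS; have := kK n; lia.
pose y : set nat := [set j | exists n, x n j].
have agree_y n : agree (K n) (x n) y.
  move=> j jK; split=> [xj|[m xm]]; first by exists n.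
  case: (leqP m n) => [/x_sub|]; first exact.
  elim: m xm => // m IH; rewrite xS ltnS => -[xm|jKm] nm.
    by move: nm; rewrite leq_eqVlt => /orP[/eqP->//|]; exact: IH.
  by have := k_mono _ _ nm; have := kK m; have : K n < k n.+1 by [];
     move: nm; rewrite leq_eqVlt => /orP[/eqP e|/k_mono]; [move: jK; rewrite jKm e|rewrite kS]; lia.
have unbounded_y : ~ bounded y.
  move=> [m hm]; have : y (K m) by exists m.+1; right.
  by move/hm; have := kK m; have := n_le_k m; lia.
have bounded_x n : bounded (x n) by exists (k n) => j /x_lt.
(* The limit [y] has a decision point [q]; stage [n] comes after the use of that
   decision and after the number [q] itself. *)
have [[q N] /= [_ illq decq]] := step (y, 0).
pose n := maxn N q.+1.
have yx : agree N y (x n).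
  by apply/agree_sym/(agreeW _ (agree_y n)); have := kK n; have := n_le_k n; lia.
have [decqx Lqq _] := decq _ yx.
have not_illq : ~ ill_below (L (x n)) q by move/decqx => [/(_ (bounded_x n))].
have [_ illp decp] := nextP (s n).
have [decpy _ Lpy] := decp y (agree_y n).
have [_ Lpp _] := decp (x n) (@agree_refl _ _).
have [_ _ _ total] := linL (x n).
(* In the order of [x n]: if [q] is below [p n], this persists to [y], and the
   descent below [q] contradicts the decision at [p n]; otherwise the descent
   below [p n] contradicts the decision at [q]. *)
have [||Lqp|Lpq] := total q (p n); [by exists q; left|by exists (p n); left| |].
  apply/unbounded_y/(decpy _).2; last exact: bounded_x.
  apply: ill_below_le illq => //; apply: Lpy => //.
  by have := n_le_k n; rewrite -/(k n); lia.
by apply: not_illq; apply: ill_below_le Lpq illp.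
Qed.

(** * The diagonal instances *)

Lemma reduction_on_relations Phi Psi :
  (forall X, inputs FP_Sigma02 X ->
    exists2 Z, computes Phi X Z &
      inputs ATR2 Z /\
      forall Y, outputs ATR2 Z Y ->
        exists2 W, computes Psi (join X Y) W & outputs FP_Sigma02 X W) ->
  forall A, exists LB : set nat * set nat,
    [/\ linear_order LB.1, computes Phi (FP_instance A) (join LB.1 LB.2) &
        forall Y, jump_hierarchy LB.1 LB.2 Y \/ descending_seq LB.1 Y ->
          exists2 W, computes Psi (join (FP_instance A) Y) W &
                     operator compare_formula A W = W].
Proof.
move=> red A.
have [|Z PhiZ [[L [B [linL eZ]]] out]] := red (FP_instance A).
  by exists A, compare_formula; exact: FP_instance_input.
exists (L, B); split=> //=; first by rewrite -eZ.
move=> Y hY; have [|W PsiW [A' [f [[_ _ e] fix_W]]]] := out Y.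
  by exists L, B; split.
exists W => //.
have [eA ef] := join_inj e.
have ff : compare_formula = f.
  apply: formula_num_inj.
  by have : [set formula_num compare_formula] (formula_num compare_formula) by []; rewrite ef.
by rewrite -eA -ff in fix_W.
Qed.

(** A fixed point of the operator at the code of [edge] is a comparison on the
    nodes: all predecessors of a coded node are coded nodes. *)
Lemma fixed_point_comparison C x A W :
  A = edge_set C x A -> operator compare_formula A W = W ->
  comparison (edge C x A) (fun u v => W (sqpair (node_num u) (node_num v))).
Proof.
move=> eA fixW u v; rewrite -{1}fixW operator_compareE; split.
  move=> [b Ab h]; have : edge_set C x A (sqpair b (node_num v)) by rewrite -eA.
  move=> [w [v' [/sqpair_inj[eb /node_num_inj ev] wv]]]; subst v' b; exists w => //.
  by move=> w' w'u; apply: h; rewrite eA; apply/edge_setE.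
move=> [w wv h]; exists (node_num w); first by rewrite eA; apply/edge_setE.
move=> a'; rewrite eA => -[w' [u' [/sqpair_inj[-> /node_num_inj eu] w'u]]].
by apply: h; rewrite eu.
Qed.

Definition root_query : nat :=
  sqpair (node_num (Branch true [::])) (node_num (Branch false [::])).
Definition bound_query : nat := sqpair (node_num LStar) (node_num RStar).

(** The condition for tree [i] to be ill-founded.  One set [U] packs the instance
    computed by [Phi] and a hierarchy for it, so that a single set quantifier has
    to be turned into a tree. *)
Definition root_answer (Phi Psi : code) (i : bool) (A : set nat) : Prop :=
  exists U, [/\ computes Phi (FP_instance A) (evens U),
    jump_hierarchy (evens (evens U)) (odds (evens U)) (odds U) &
    eval (join (FP_instance A) (odds U)) Psi root_query i].

Lemma analytic_root_answer Phi Psi i : analytic (root_answer Phi Psi i).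
Proof.
have hA : borel_map evens by move=> n; exact: borel_mem.
have hU n : borel (fun O => odds O n) by exact: borel_mem.
have hFP : borel_map (fun O => FP_instance (evens O)).
  by apply: borel_map_join => // n; exact: borel_const.
have hY : borel_map (fun O => odds (odds O)) by move=> n; exact: hU.
have hP : borel (fun O =>
    computes Phi (FP_instance (evens O)) (evens (odds O)) /\
    (jump_hierarchy (evens (evens (odds O))) (odds (evens (odds O))) (odds (odds O)) /\
     eval (join (FP_instance (evens O)) (odds (odds O))) Psi root_query i)).
  apply: borelI; first by apply: borel_computes => // n; exact: hU.
  apply: borelI; first by apply: borel_jump_hierarchy => // n; exact: hU.
  exact: borel_comp (borel_eval Psi root_query i) (borel_map_join hFP hY).
apply: analytic_ext (analytic_proj hP) => A.
split=> -[U ansU]; exists U; rewrite ?evens_join ?odds_join in ansU *.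
  by case: ansU.
by case: ansU => ? [].
Qed.

(** With a well-founded order there is a unique hierarchy, and the truth value
    [i] of its answer is the only one for which tree [i] is ill-founded.  If the
    answer is yes, the ill-founded root of tree [true] was claimed to have smaller
    rank than the well-founded root of tree [false]; if it is no, the well-founded
    root of tree [true] was denied to have smaller rank than an ill-founded one. *)
Lemma diagonal_ill_founded Phi Psi C x A L B :
  (forall i, closed (C i)) ->
  (forall i A, root_answer Phi Psi i A <-> exists z, C i A z) ->
  A = edge_set C x A ->
  computes Phi (FP_instance A) (join L B) ->
  (forall Y, jump_hierarchy L B Y \/ descending_seq L Y ->
    exists2 W, computes Psi (join (FP_instance A) Y) W &
               operator compare_formula A W = W) ->
  exists f, descends (lo_lt L) f.
Proof.
move=> clC hC eA PhiLB out; apply: contrapT => no_desc.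
have wfL : well_founded (lo_lt L).
  move=> i; apply: contrapT => ni; apply: no_desc.
  by have [f _ fd] := notAcc_descends ni; exists f.
have [Y hY] := jump_hierarchy_exists B wfL.
have [W PsiW fixW] := out Y (or_introl hY).
have cmp := fixed_point_comparison eA fixW.
have ill i : ~ Acc (edge C x A) (Branch i [::]) <-> (W root_query <-> i = true).
  rewrite branch_ill // -hC; split.
    move=> [U [PhiU hU PsiU]].
    move: (computes_det PhiLB PhiU) => e; move: hU PsiU.
    rewrite -e evens_join odds_join => hU.
    rewrite -(jump_hierarchy_unique wfL hY hU) => /(computes_evalE PsiW) ->.
    by case: (i).
  move=> Wi; exists (join (join L B) Y).
  rewrite !(evens_join, odds_join); split=> //.
  case: i Wi => -[Wi Wi'] /=; first exact: computes_eval1 PsiW (Wi' erefl).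
  by apply: computes_eval0 PsiW _ => /Wi.
case: (pselect (W root_query)) => Wq.
  have acc0 : Acc (edge C x A) (Branch false [::]).
    by apply: contrapT => /ill[/(_ Wq)].
  have ill1 : ~ Acc (edge C x A) (Branch true [::]) by apply/ill; split.
  exact: (comparison_ill_wf cmp ill1 acc0) Wq.
have acc1 : Acc (edge C x A) (Branch true [::]).
  by apply: contrapT => /ill[_ /(_ erefl)].
have ill0 : ~ Acc (edge C x A) (Branch false [::]) by apply/ill; split.
exact/Wq/(comparison_wf_ill cmp acc1 ill0).
Qed.

(** The pair of [n] and [f n] is at least [n], so [graph f] below [m] sees at most
    the first [m] values. *)
Lemma agree_graph m f g :
  (forall n, n < m -> f n = g n) -> agree m (graph f) (graph g).
Proof.
move=> fg k km; split=> -[n en]; exists n; rewrite en.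
  by rewrite fg //; apply: leq_ltn_trans km; rewrite en; exact: npair_ge.
by rewrite fg //; apply: leq_ltn_trans km; rewrite en; exact: npair_ge.
Qed.

Theorem theorem3p10 : ~ (FP_Sigma02 <=W ATR2).
Proof.
move=> [Phi [Psi /reduction_on_relations /choice[LB redLB]]].
have [C hC] := choice (analytic_root_answer Phi Psi).
have clC i : closed (C i) by case: (hC i).
have [G [GE Gcont]] := guarded_fixpoint (@edge_set_guarded C).
pose L x := (LB (G x)).1.
have linL x : linear_order (L x) by have [] := redLB (G x).
have illL x : exists f, descends (lo_lt (L x)) f.
  have [_ PhiLB out] := redLB (G x).
  by apply: (diagonal_ill_founded clC _ (GE x) PhiLB out) => i A; case: (hC i).
have contL x k : locally x (fun x' => L x k <-> L x' k).
  have [_ PhiLB _] := redLB (G x).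
  have [m hm] := computes_use k.*2 PhiLB; exists m => x' /Gcont xx'.
  have [_ PhiLB' _] := redLB (G x').
  have h := hm _ (agree_FP_instance xx') _ PhiLB'.
  by move: h; rewrite /join /= odd_double doubleK.
apply: (no_decision_of_boundedness linL contL) => x.
have decides z f : descends (lo_lt (L z)) f ->
    exists2 W, computes Psi (join (FP_instance (G z)) (graph f)) W &
               W bound_query <-> bounded z.
  move=> fd; have [_ _ out] := redLB (G z).
  have [|W PsiW fixW] := out (graph f); first by right; exists f.
  exists W => //; exact: comparison_bounded (fixed_point_comparison (GE z) fixW).
have [f fd] := illL x; have [W PsiW Wx] := decides x f fd.
have [m hm] := computes_use bound_query PsiW.
exists (f m); first by exists (fun n => f (m.+1 + n)) => [n|]; rewrite ?addnS ?addn0; exact: fd.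
have loc_m : locally x (agree m x) by exists m.
have loc_f := locally_all_lt (fun n (_ : n < m) => contL x (npair (f n.+1) (f n))).
apply: locallyW (locallyI loc_m loc_f) => x' [xx' ff'] [g gd gf].
(* The first elements of [f], which carry the decision, continued by the
   descent [g] below [f m]. *)
pose h n := if n <= m then f n else g (n - m.+1).
have hd : descends (lo_lt (L x')) h.
  move=> n; rewrite /h; case: (ltngtP n m) => nm.
  - by have [le ne] := fd n; split=> //; apply/ff'.
  - by rewrite subSn; [exact: gd|lia].
  - by rewrite nm subnn.
have [W' PsiW' Wx'] := decides x' h hd.
rewrite -Wx -Wx'; suff -> : W bound_query <-> W' bound_query by [].
apply: hm PsiW'; apply: agree_join; first exact/agree_FP_instance/Gcont.
by apply: agree_graph => n nm; rewrite /h ltnW.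
Qed.
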